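(* Let $\langle X,\tau^0,\tau^1\rangle$ be a $\mathbf{CL}$-space. The following are equivalent: (1) $\langle X,\tau^0,\tau^1\rangle$ is an $\mathbf{IL}$-space; (2) for every $U\in\tau^1$ and every $Y\subseteq X$, $d_{\tau^0}(d_{\tau^0}(Y)\cap U)\subseteq d_{\tau^0}(Y\cap U)$; (3) for every $U\in\tau^1$, $d_{\tau^0}(d_{\tau^0}(X\setminus U)\cap U)=\varnothing$; (4) for every $U\in\tau^1$ there exists $V\in\tau^0$ with $V\subseteq U$ and $d_{\tau^0}(U\setminus V)=\varnothing$.
   Context: $\mathcal{L}(\Box,\rhd)$ has propositional variables, $\top,\bot$, $\neg,\land,\lor,\to$, unary $\Box,\Diamond$ ($\Diamond$ dual of $\Box$) and binary $\rhd$. $\mathbf{CL}$ is the smallest set of formulas containing all propositional tautologies, $\Box(p\to q)\to(\Box p\to\Box q)$, $\Box(\Box p\to p)\to\Box p$, J1: $\Box(p\to q)\to(p\rhd q)$; J2: $(p\rhd q)\land(q\rhd r)\to(p\rhd r)$; J3: $(p\rhd r)\land(q\rhd r)\to((p\lor q)\rhd r)$; J4: $(p\rhd q)\to(\Diamond p\to\Diamond q)$, closed under modus ponens, necessitation and substitution; $\mathbf{IL}$ is the smallest such set also containing J5: $\Diamond p\rhd p$. For a topology $\tau$, $d_\tau(Y)=\{x: \text{every } U\in\tau \text{ containing } x \text{ meets } Y\setminus\{x\}\}$, $cd_\tau(Y)=X\setminus d_\tau(X\setminus Y)$. A bitopological space is $\langle X,\tau^0,\tau^1\rangle$ with $X\ne\varnothing$,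 $\tau^0,\tau^1$ topologies. $e_{\tau^0,\tau^1}(Y,Z)=\{x:\forall U\in\tau^1[x\in d_{\tau^0}(Y\cap U)\Rightarrow x\in d_{\tau^0}(Z\cap U)]\}$. A valuation $v$ maps formulas to subsets of $X$, Boolean on connectives, with $v(\Box\varphi)=cd_{\tau^0}(v(\varphi))$, $v(\Diamond\varphi)=d_{\tau^0}(v(\varphi))$, $v(\varphi\rhd\psi)=e_{\tau^0,\tau^1}(v(\varphi),v(\psi))$. $\mathrm{Log}(X,\tau^0,\tau^1)$ is the set of $\varphi$ with $v(\varphi)=X$ for all $v$. For a logic $L$, an $L$-space is a bitopological space with $L\subseteq\mathrm{Log}(X,\tau^0,\tau^1)$. *)

(* Defs.v *)
From mathcomp Require Import all_boot.
From mathcomp Require Import boolp classical_sets.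

Set Implicit Arguments.
Unset Strict Implicit.
Unset Printing Implicit Defensive.

Local Open Scope classical_set_scope.

Inductive form : Type :=
| Var of nat
| Top
| Bot
| Neg of form
| And of form & form
| Or of form & form
| Imp of form & form
| Box of form
| Dia of form
| Rhd of form & form.

Fixpoint subst (s : nat -> form) (A : form) : form :=
  match A with
  | Var n => s n
  | Top => Top
  | Bot => Bot
  | Neg A => Neg (subst s A)
  | And A B => And (subst s A) (subst s B)
  | Or A B => Or (subst s A) (subst s B)
  | Imp A B => Imp (subst s A) (subst s B)
  | Box A => Box (subst s A)
  | Dia A => Dia (subst s A)
  | Rhd A B => Rhd (subst s A) (subst s B)
  end.

(* Truth assignments are free on variables and on formulas whose main
   connective is modal. *)
Record truth_assignment (h : form -> bool) : Prop := TruthAssignment {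
  truth_top : h Top = true;
  truth_bot : h Bot = false;
  truth_neg : forall A, h (Neg A) = ~~ h A;
  truth_and : forall A B, h (And A B) = h A && h B;
  truth_or : forall A B, h (Or A B) = h A || h B;
  truth_imp : forall A B, h (Imp A B) = (h A ==> h B) }.

Definition tautology (A : form) : Prop :=
  forall h, truth_assignment h -> h A.

Declare Scope il_scope.
Delimit Scope il_scope with IL.
Bind Scope il_scope with form.
Local Notation "A && B" := (And A B) : il_scope.
Local Notation "A || B" := (Or A B) : il_scope.
Local Notation "A ==> B" := (Imp A B) : il_scope.
Local Notation "A |> B" := (Rhd A B)
  (at level 52, no associativity) : il_scope.
Local Notation p := (Var 0).
Local Notation q := (Var 1).
Local Notation r := (Var 2).

(* Dia is a primitive connective; its being the dual of Box is expressed by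
   the two axioms CL_dual1 and CL_dual2. *)
Inductive CL_axiom : form -> Prop :=
| CL_taut A of tautology A : CL_axiom A
| CL_dual1 : CL_axiom (Dia p ==> Neg (Box (Neg p)))
| CL_dual2 : CL_axiom (Neg (Box (Neg p)) ==> Dia p)
| CL_K : CL_axiom (Box (p ==> q) ==> (Box p ==> Box q))
| CL_Lob : CL_axiom (Box (Box p ==> p) ==> Box p)
| CL_J1 : CL_axiom (Box (p ==> q) ==> (p |> q))
| CL_J2 : CL_axiom ((p |> q) && (q |> r) ==> (p |> r))
| CL_J3 : CL_axiom ((p |> r) && (q |> r) ==> ((p || q) |> r))
| CL_J4 : CL_axiom ((p |> q) ==> (Dia p ==> Dia q)).

Definition J5 : form := (Dia p |> p)%IL.

Record logic_closed (L : set form) : Prop := LogicClosed {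
  closed_mp : forall A B, L (Imp A B) -> L A -> L B;
  closed_nec : forall A, L A -> L (Box A);
  closed_subst : forall s A, L A -> L (subst s A) }.

Definition CL : set form := smallest logic_closed CL_axiom.

Definition IL : set form := smallest logic_closed (CL_axiom `|` [set J5]).

(* Topologies are given by their sets of opens, rather than by topologicalType
   instances, since two of them live on the same carrier. *)
Record is_topology (X : Type) (tau : set (set X)) : Prop := IsTopology {
  open_set0 : tau set0;
  open_setT : tau setT;
  open_setI : forall U V, tau U -> tau V -> tau (U `&` V);
  open_bigcup : forall F : set (set X), F `<=` tau ->
    tau (\bigcup_(U in F) U) }.

Record bitopological (X : Type) (tau0 tau1 : set (set X)) : Prop :=
  Bitopological {
    bitop_nonempty : [set: X] !=set0;
    bitop_topology0 : is_topology tau0;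
    bitop_topology1 : is_topology tau1 }.

Section Semantics.
Variable X : Type.
Implicit Types (tau : set (set X)) (Y Z : set X).

Definition derived tau Y : set X :=
  [set x | forall U, tau U -> U x -> U `&` (Y `\ x) !=set0].

Definition coderived tau Y : set X := ~` derived tau (~` Y).

Definition rhd_op tau0 tau1 Y Z : set X :=
  [set x | forall U, tau1 U ->
     derived tau0 (Y `&` U) x -> derived tau0 (Z `&` U) x].

Record valuation tau0 tau1 (v : form -> set X) : Prop := Valuation {
  val_top : v Top = setT;
  val_bot : v Bot = set0;
  val_neg : forall A, v (Neg A) = ~` v A;
  val_and : forall A B, v (And A B) = v A `&` v B;
  val_or : forall A B, v (Or A B) = v A `|` v B;
  val_imp : forall A B, v (Imp A B) = ~` v A `|` v B;
  val_box : forall A, v (Box A) = coderived tau0 (v A);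
  val_dia : forall A, v (Dia A) = derived tau0 (v A);
  val_rhd : forall A B, v (Rhd A B) = rhd_op tau0 tau1 (v A) (v B) }.

Definition Log tau0 tau1 : set form :=
  [set A | forall v, valuation tau0 tau1 v -> v A = setT].

Definition logic_space (L : set form) tau0 tau1 : Prop :=
  bitopological tau0 tau1 /\ L `<=` Log tau0 tau1.

End Semantics.

(* Main.v *)
Require Import Defs.
From mathcomp Require Import all_boot.
From mathcomp Require Import boolp classical_sets.
Local Open Scope classical_set_scope.

(** Löb's axiom says that [d Y] is contained in [d (Y \ d Y)], where [d] is the
    derivative of [tau0]; applied to the union of [Y] and [d Y], it makes [d]
    transitive: [d (d Y)] is contained in [d Y].  J5 is condition (2) read
    pointwise.  For (3) => (4) take [V] to be the [tau0]-interior of [U]: points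
    of [U] outside [V] are limits of the complement of [U].  For (4) => (1),
    [d (U \ V)] being empty, [U] may be replaced by the open set [V], and points
    of [V] in [d Y] are limits of the points of [Y] lying in [V]; transitivity
    of [d] concludes. *)

Section Derived.
Context {X : Type} (tau : set (set X)).
Implicit Types Y Z U V : set X.

Lemma derivedS Y Z : Y `<=` Z -> derived tau Y `<=` derived tau Z.
Proof.
move=> YZ x dY U tU Ux; have [y [Uy [Yy yx]]] := dY U tU Ux.
by exists y; split=> //; split=> //; exact: YZ.
Qed.

Hypothesis top : is_topology tau.

Lemma derived0 : derived tau set0 = set0.
Proof.
apply/seteqP; split=> x //= d0.
by have [y [_ []]] := d0 setT (open_setT top) I.
Qed.

Lemma derivedU Y Z : derived tau (Y `|` Z) = derived tau Y `|` derived tau Z.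
Proof.
apply/seteqP; split=> [x dYZ|x]; last first.
  by case; apply: derivedS => y; [left|right].
(* Neighbourhoods of [x] that refute the limit property for [Y] and for [Z] intersect in one that
   refutes it for the union. *)
apply: contrapT => /not_orP[/existsNP[U /not_implyP[tU /not_implyP[Ux nU]]]].
move=> /existsNP[V /not_implyP[tV /not_implyP[Vx nV]]].
have [y [[Uy Vy] [[Yy|Zy] yx]]] := dYZ _ (open_setI top tU tV) (conj Ux Vx).
- by apply: nU; exists y.
- by apply: nV; exists y.
Qed.

Lemma derived_setI_open Y V :
  tau V -> derived tau Y `&` V `<=` derived tau (Y `&` V).
Proof.
move=> tV x [dY Vx] U tU Ux.
have [y [[Uy Vy] [Yy yx]]] := dY _ (open_setI top tU tV) (conj Ux Vx).
by exists y.
Qed.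

Lemma derived_trans :
  (forall Y, derived tau Y `<=` derived tau (Y `\` derived tau Y)) ->
  forall Y, derived tau (derived tau Y) `<=` derived tau Y.
Proof.
move=> lob Y x ddY; have := lob (Y `|` derived tau Y) x.
(* The derivative of the union contains [derived tau Y], so removing it from the union leaves only
   points of [Y]. *)
rewrite derivedU => /(_ (or_intror ddY)); apply: derivedS => y [[]//= dY []].
by left.
Qed.

Lemma exists_open_core U :
  exists V, [/\ tau V, V `<=` U & U `\` V `<=` derived tau (~` U) `&` U].
Proof.
exists (\bigcup_(W in [set W | tau W /\ W `<=` U]) W); split.
- by apply: (open_bigcup top) => W [].
- by move=> x [W [_ WU] /WU].
(* No neighbourhood of [x] lies inside [U], and a point of it outside [U] differs from [x], which is
   in [U]. *)
- move=> x [Ux nx]; split=> // W tW Wx; apply: contrapT => nW.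
  apply: nx; exists W => //; split=> // y Wy; apply: contrapT => nUy.
  by apply: nW; exists y; split=> //; split=> // yx; apply: nUy; rewrite yx.
Qed.

End Derived.

Section Soundness.
Context {X : Type} (tau0 tau1 : set (set X)).

(** Provides a valuation with prescribed values on the variables, so that a valid axiom can be used
    at chosen sets. *)
Fixpoint eval (rho : nat -> set X) (A : form) : set X :=
  match A with
  | Var n => rho n
  | Top => setT
  | Bot => set0
  | Neg A => ~` eval rho A
  | And A B => eval rho A `&` eval rho B
  | Or A B => eval rho A `|` eval rho B
  | Imp A B => ~` eval rho A `|` eval rho B
  | Box A => coderived tau0 (eval rho A)
  | Dia A => derived tau0 (eval rho A)
  | Rhd A B => rhd_op tau0 tau1 (eval rho A) (eval rho B)
  end.

Lemma eval_valuation rho : valuation tau0 tau1 (eval rho).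
Proof. by split. Qed.

Lemma subst_valuation v s :
  valuation tau0 tau1 v -> valuation tau0 tau1 (fun A => v (subst s A)).
Proof.
by move=> [v1 v2 v3 v4 v5 v6 v7 v8 v9]; split=> /= *;
  rewrite ?(v1, v2, v3, v4, v5, v6, v7, v8, v9).
Qed.

(** Makes [Log tau0 tau1] one of the sets intersected in the definition of [IL], so that only the
    axioms need checking. *)
Lemma Log_closed : is_topology tau0 -> logic_closed (Log tau0 tau1).
Proof.
move=> top; split=> [A B lAB lA v vv|A lA v vv|s A lA v vv].
- have := lAB v vv; rewrite (val_imp vv) (lA v vv) setCT set0U.
  exact.
- by rewrite (val_box vv) (lA v vv) /coderived setCT derived0 // setC0.
- exact: (lA _ (subst_valuation _ s vv)).
Qed.

Lemma CL_axiom_CL : CL_axiom `<=` CL.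
Proof. exact: sub_smallest. Qed.

Lemma IL_space_iff : logic_space CL tau0 tau1 ->
  logic_space IL tau0 tau1 <->
  (forall U, tau1 U -> forall Y,
     derived tau0 (derived tau0 Y `&` U) `<=` derived tau0 (Y `&` U)).
Proof.
move=> [bt CLlog]; split=> [[_ ILlog] U tU Y x dY|H].
  have J5IL : IL J5 by move=> L [_]; apply; right.
  have J5x : eval (fun=> Y) J5 x by rewrite (ILlog _ J5IL _ (eval_valuation _)).
  exact: J5x.
split=> // A ILA; apply: (ILA (Log tau0 tau1)); split.
  exact: Log_closed (bitop_topology0 bt).
move=> B [/CL_axiom_CL/CLlog //|->] v vv.
rewrite (val_rhd vv) (val_dia vv); apply/seteqP; split=> // x _ U tU.
exact: H.
Qed.

Lemma CL_space_derived_lob : logic_space CL tau0 tau1 ->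
  forall Y, derived tau0 Y `<=` derived tau0 (Y `\` derived tau0 Y).
Proof.
move=> [_ CLlog] Y x dY.
have lobT := CLlog _ (CL_axiom_CL _ CL_Lob) _ (eval_valuation (fun=> ~` Y)).
have : [set: X] x by [].
rewrite -lobT /= /coderived !setCK => -[|//].
by rewrite setCU setCK setIC; exact: contrapT.
Qed.

End Soundness.

Theorem theorem5p1 (X : Type) (tau0 tau1 : set (set X))
    (hCL : logic_space CL tau0 tau1) :
  [<-> logic_space IL tau0 tau1;
       forall (U : set X), tau1 U -> forall Y : set X,
         derived tau0 (derived tau0 Y `&` U) `<=` derived tau0 (Y `&` U);
       forall (U : set X), tau1 U ->
         derived tau0 (derived tau0 (~` U) `&` U) = set0;
       forall (U : set X), tau1 U ->
         exists V : set X,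
           [/\ tau0 V, V `<=` U & derived tau0 (U `\` V) = set0] ].
Proof.
have top := bitop_topology0 (proj1 hCL).
tfae.
- by move/(IL_space_iff _ _ hCL).
(* Here [Y] is the complement of [U], so its trace on [U] is empty. *)
- move=> H U tU; apply/seteqP; split=> // x /(H U tU).
  by rewrite setICl derived0.
- move=> H U tU; have [V [tV VU UV]] := exists_open_core _ top U.
  exists V; split=> //; apply/seteqP; split=> // x /(derivedS _ _ _ UV).
  by rewrite H.
- move=> H; apply/(IL_space_iff _ _ hCL) => U tU Y x dYU.
  have [V [tV VU UV]] := H U tU.
  have lob := CL_space_derived_lob _ _ hCL.
  have : derived tau0 ((derived tau0 Y `&` V) `|` (U `\` V)) x.
    apply: derivedS dYU => y [dY Uy].
    by have [Vy|nVy] := EM (V y); [left|right].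
  rewrite derivedU // UV setU0 => dYV.
  have YVU : Y `&` V `<=` Y `&` U by move=> y [Yy /VU].
  apply: (derivedS _ _ _ YVU); apply: derived_trans => //.
  apply: derivedS dYV; exact: derived_setI_open.
Qed.
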